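(* Let $b\ge 2$ be an integer, let $X$ be a Benford variable (base $b$), and let $\mathbf{A}_k=[A_1,\ldots,A_k]$, $k\ge 1$, be the first $k$ coefficients (excluding $A_0$) of the simple continued fraction $\log_b X=[A_0;A_1,A_2,\ldots]$. Then for every $\mathbf{a}_k=[a_1,\ldots,a_k]\in\mathbb{N}^k$, $$\Pr(\mathbf{A}_k=\mathbf{a}_k)=(-1)^k\big([0;\mathbf{a}_k+\mathbf{e}_k]-[0;\mathbf{a}_k]\big).$$
   Context: $\mathbb{N}$ excludes zero. A Benford variable (base $b$) is a positive continuous random variable $X$ such that the fractional part $\{\log_b X\}$ is uniformly distributed on $(0,1)$, where $\{z\}=z-\lfloor z\rfloor$. With $Y_0=\log_b X$, the continued fraction coefficients are defined by $Y_j=\{Y_{j-1}\}^{-1}$ and $A_j=\lfloor Y_j\rfloor$ for $j\ge1$ (almost surely well defined, since $\log_b X$ is almost surely irrational). $\mathbf{e}_k=[0,\ldots,0,1]$ is the $k$-vector with a one in position $k$ and zeros elsewhere. $[0;\mathbf{a}_k]=[0;a_1,\ldots,a_k]$ denotes the finite simple continued fraction $\cfrac{1}{a_1+\cfrac{1}{a_2+\cdots+\cfrac{1}{a_k}}}$, and so $[0;\mathbf{a}_k+\mathbf{e}_k]=[0;a_1,\ldots,a_{k-1},a_k+1]$. *)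

(* Defs.v *)
From HB Require Import structures.
From mathcomp Require Import all_boot all_order all_algebra.
From mathcomp Require Import all_classical all_reals all_analysis.

Set Implicit Arguments.
Unset Strict Implicit.
Unset Printing Implicit Defensive.

Import Order.TTheory GRing.Theory Num.Theory.
Import numFieldNormedType.Exports.

Local Open Scope classical_set_scope.
Local Open Scope ring_scope.

Definition logb (R : realType) (b : nat) (x : R) : R := ln x / ln b%:R.

Definition fracpart (R : realType) (z : R) : R := z - (Num.floor z)%:~R.

(* The cumulative distribution function of X is continuous, i.e., the law of X
   has no atoms; every law with a density qualifies. *)
Definition continuous_rv d (T : measurableType d) (R : realType)
    (P : probability T R) (X : {RV P >-> R}) : Prop :=
  continuous (cdf X).

(* [uniform_prob (@ltr01 R)] is the uniform law on [0, 1], which is the same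
   measure as the uniform law on the open interval. Laws are compared on
   measurable sets only: a measure is a function on all sets, and its values on
   the other ones are meaningless. *)
Definition benford d (T : measurableType d) (R : realType)
    (P : probability T R) (b : nat) (X : {RV P >-> R}) : Prop :=
  [/\ {ae P, forall t, 0 < X t},
      continuous_rv X
    & forall B : set R, measurable B ->
        P [set t | B (fracpart (logb b (X t)))] = uniform_prob (@ltr01 R) B].

(* As 0^-1 = 0 in MathComp, if y is rational then the expansion continues with
   cf_rem y j = 0, hence cf_coef y j = 0, at the first j where the algorithm
   should have stopped; 0 is not a legitimate coefficient of index j >= 1. *)
Fixpoint cf_rem (R : realType) (y : R) (j : nat) : R :=
  if j is j'.+1 then (fracpart (cf_rem y j'))^-1 else y.

Definition cf_coef (R : realType) (y : R) (j : nat) : int :=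
  Num.floor (cf_rem y j).

(* The vector [A_1, ..., A_k]: position i : 'I_k holds the coefficient of
   index i.+1, so that A_0 is left out. *)
Definition cf_coefs (R : realType) (k : nat) (y : R) : 'rV[int]_k :=
  \row_(i < k) cf_coef y i.+1.

(* [0; a_1, ..., a_k] *)
Definition cf_value (R : realType) (k : nat) (a : 'rV[nat]_k) : R :=
  foldr (fun (c : nat) (x : R) => (c%:R + x)^-1) 0 [seq a ord0 i | i <- enum 'I_k].

(* The last basis vector [0, ..., 0, 1]. *)
Definition e_last (k : nat) : 'rV[nat]_k :=
  \row_(i < k) (i.+1 == k : nat).

(* Main.v *)
Require Import Defs.
From HB Require Import structures.
From mathcomp Require Import all_boot all_order all_algebra.
From mathcomp Require Import all_classical all_reals all_analysis.
From mathcomp Require Import measurable_realfun ring lra.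

Set Implicit Arguments.
Unset Strict Implicit.
Unset Printing Implicit Defensive.

Import Order.TTheory GRing.Theory Num.Theory.
Import numFieldNormedType.Exports.

Local Open Scope classical_set_scope.
Local Open Scope ring_scope.

(** The coefficients of index at least 1 depend only on the fractional part u
    of log_b X, which is uniform on [0, 1], so the probability is the length of
    the set of u in [0, 1) whose expansion starts with a_1, ..., a_k (a
    cylinder, [cf_cylinder]).  Write f(x) = 1/(a_1 + 1/(a_2 + ... 1/(a_k + x)))
    ([cf_fold]).  A number u lies in the cylinder of c :: s exactly when
    u = 1/(c + v) with v in the cylinder of s, up to endpoints, and
    v |-> 1/(c + v) is a decreasing homeomorphism from [0, 1] onto its image.
    By induction the cylinder is an interval with endpoints f(0) and f(1)
    ([cf_cylinder_sandwich]), and f is increasing or decreasing according to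
    the parity of k ([cf_fold_sign]), so the length is (-1)^k (f(1) - f(0)).
    Finally f(0) = [0; a_1, ..., a_k] and f(1) = [0; a_1, ..., a_k + 1]
    ([cf_value_e_last]).

    Which endpoints belong to the cylinder depends on the word: 1 belongs to no
    cylinder, although 1 = 1/(1 + 0).  It is therefore only shown that the
    cylinder contains the open interval and is contained in the closed one;
    this determines its length, and also makes it an interval, hence
    measurable. *)

Lemma fracpart_itv (R : realType) (z : R) : 0 <= fracpart z < 1.
Proof.
rewrite /fracpart; have /andP[h1 h2] := floor_itv z.
by rewrite subr_ge0 h1 /= ltrBlDl -[X in _ + X]/(1%:~R) -intrD.
Qed.

Lemma fracpart_id (R : realType) (z : R) : 0 <= z < 1 -> fracpart z = z.
Proof.
move=> z01; rewrite /fracpart (@floor_def _ z 0) ?add0r//.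
by rewrite subr0.
Qed.

Lemma cf_remSr (R : realType) (y : R) (j : nat) :
  cf_rem y j.+1 = cf_rem (fracpart y)^-1 j.
Proof. by elim: j => //= j ->. Qed.

Lemma cf_coef_fracpart (R : realType) (y : R) (j : nat) :
  cf_coef (fracpart y) j.+1 = cf_coef y j.+1.
Proof.
by rewrite /cf_coef !cf_remSr fracpart_id// fracpart_itv.
Qed.

(** The restriction to [0, 1) makes membership of a fractional part a condition
    on the coefficients alone, and bounds the cylinder, as the interval
    description requires when [s] is empty. *)
Definition cf_cylinder (R : realType) (s : seq nat) : set R :=
  [set u | 0 <= u < 1 /\
           forall i, (i < size s)%N -> cf_coef u i.+1 = Posz (nth 0%N s i)].

(** The continued fraction whose last complete denominator is shifted by [x]:
    it equals [0; s] at 0, and [0; s] with its last coefficient incremented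
    at 1. *)
Definition cf_fold (R : realType) (s : seq nat) (x : R) : R :=
  foldr (fun (c : nat) (x : R) => (c%:R + x)^-1) x s.

(** 1/(c + v) has first coefficient c and remainder v under the Gauss map.  The
    assumption that 1/(c + v) < 1 excludes only c = 1 and v = 0. *)
Lemma cf_cylinder_cons (R : realType) (c : nat) (s : seq nat) (v : R) :
  (0 < c)%N -> 0 <= v < 1 -> (c%:R + v)^-1 < 1 ->
  cf_cylinder (c :: s) (c%:R + v)^-1 <-> cf_cylinder s v.
Proof.
move=> c0 v01 lt1.
have cp : 1 <= c%:R :> R by rewrite ler1n.
have u01 : 0 <= (c%:R + v)^-1 < 1 by rewrite lt1 andbT invr_ge0; lra.
have fl : Num.floor (c%:R + v) = Posz c.
  by apply: floor_def; rewrite intrD -!pmulrn; lra.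
have fr : fracpart (c%:R + v) = v by rewrite /fracpart fl -pmulrn addrC addKr.
have coef1 : cf_coef (c%:R + v)^-1 1 = Posz c.
  by rewrite /cf_coef /= (fracpart_id u01) invrK.
have coefS i : cf_coef (c%:R + v)^-1 i.+2 = cf_coef v i.+1.
  by rewrite /cf_coef cf_remSr (fracpart_id u01) invrK !cf_remSr fr fracpart_id.
split=> -[_ H]; split=> // i.
  by move=> is_; rewrite -coefS (H i.+1).
by case: i => [|i] // is_; rewrite coefS H.
Qed.

(** The witness is the image of u under the Gauss map; for u = 0 the convention
    0^-1 = 0 would make the first coefficient 0, contradicting 0 < c. *)
Lemma cf_cylinder_consP (R : realType) (c : nat) (s : seq nat) (u : R) :
  (0 < c)%N -> cf_cylinder (c :: s) u ->
  exists2 v, cf_cylinder s v & u = (c%:R + v)^-1.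
Proof.
move=> c0 cu; have [u01 /(_ 0%N isT)] := cu.
rewrite /cf_coef /= (fracpart_id u01) => fl.
have uE : u = (c%:R + fracpart u^-1)^-1.
  by rewrite /fracpart fl -pmulrn addrC subrK invrK.
exists (fracpart u^-1) => //.
apply/(cf_cylinder_cons _ c0) => //; first exact: fracpart_itv.
  by rewrite -uE; case/andP: u01.
by rewrite -uE.
Qed.

(** The sign of (v - a) * (b - v) tells whether v lies between a and b, in
    whichever order these are, so this identity says that v |-> 1/(c + v)
    preserves betweenness without a case distinction on the order of a and b. *)
Lemma invD_betweenE (R : realFieldType) (c v a b : R) :
  0 < c + v -> 0 < c + a -> 0 < c + b ->
  ((c + v)^-1 - (c + a)^-1) * ((c + b)^-1 - (c + v)^-1) =
  (v - a) * (b - v) / ((c + v) ^+ 2 * (c + a) * (c + b)).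
Proof.
move=> hv ha hb; field.
by rewrite !lt0r_neq0.
Qed.

Lemma cf_fold_itv (R : realType) (s : seq nat) (x : R) :
  all (ltn 0) s -> 0 <= x <= 1 -> 0 <= cf_fold s x <= 1.
Proof.
move=> + x01; elim: s => [|c s IH] //= /andP[c0 /IH].
rewrite -/(cf_fold s x) => v01.
have cp : 1 <= c%:R :> R by rewrite ler1n.
rewrite invr_ge0 invf_le1; lra.
Qed.

(** A nonnegative product means that u is in the closed interval with endpoints
    f(0) and f(1), a positive one that u is in the open interval; since the
    order of the endpoints alternates with the length of [s], this formulation
    is the one that goes through the induction. *)
Lemma cf_cylinder_sandwich (R : realType) (s : seq nat) :
  all (ltn 0) s ->
  (forall u : R, cf_cylinder s u ->
     0 <= (u - cf_fold s 0) * (cf_fold s 1 - u)) /\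
  (forall u : R, 0 < (u - cf_fold s 0) * (cf_fold s 1 - u) ->
     cf_cylinder s u).
Proof.
elim: s => [_|c s IH /= /andP[c0 s0]].
  split=> u; rewrite /cf_cylinder /=; first by case=> u01 _; nra.
  by move=> hu; split=> //; apply/andP; split; nra.
have {IH}[sub sup] := IH s0.
have cp : 1 <= c%:R :> R by rewrite ler1n.
have /andP[f0 f0'] : 0 <= cf_fold s (0 : R) <= 1
  by apply: cf_fold_itv; rewrite // lexx ler01.
have /andP[f1 f1'] : 0 <= cf_fold s (1 : R) <= 1
  by apply: cf_fold_itv; rewrite // lexx ler01.
rewrite -!/(cf_fold s _).
split=> u.
  move=> /(cf_cylinder_consP c0)[v sv ->].
  have [/andP[v0 v1] _] := sv.
  rewrite invD_betweenE; [|lra..].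
  apply: divr_ge0; first exact: sub.
  by rewrite !mulr_ge0 ?exprn_ge0//; lra.
move=> hu.
have /andP[g0 g0'] : 0 <= (c%:R + cf_fold s (0 : R))^-1 <= 1.
  rewrite invr_ge0 invf_le1; lra.
have /andP[g1 g1'] : 0 <= (c%:R + cf_fold s (1 : R))^-1 <= 1.
  rewrite invr_ge0 invf_le1; lra.
(* u is strictly between two points of [0, 1]. *)
have u0 : 0 < u by nra.
have u1 : u < 1 by nra.
pose v := u^-1 - c%:R.
have uE : u = (c%:R + v)^-1 by rewrite /v addrC subrK invrK.
have cv : 0 < c%:R + v by rewrite /v addrC subrK invr_gt0.
have {}hu : 0 < (v - cf_fold s 0) * (cf_fold s 1 - v).
  have ca : 0 < c%:R + cf_fold s (0 : R) by lra.
  have cb : 0 < c%:R + cf_fold s (1 : R) by lra.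
  move: hu; rewrite uE invD_betweenE// pmulr_lgt0// invr_gt0.
  by rewrite !mulr_gt0// exprn_gt0.
have v01 : 0 <= v < 1 by apply/andP; split; nra.
by rewrite uE; apply/cf_cylinder_cons => //; [rewrite -uE|exact: sup].
Qed.

(** Each map x |-> 1/(c + x) reverses the order of the endpoints once. *)
Lemma cf_fold_sign (R : realType) (s : seq nat) :
  all (ltn 0) s ->
  0 <= (-1) ^+ size s * (cf_fold s 1 - cf_fold s 0) :> R.
Proof.
elim: s => [_|c s IH /= /andP[c0 s0]]; first by rewrite /= mul1r subr0 ler01.
have cp : 1 <= c%:R :> R by rewrite ler1n.
have /andP[f0 f0'] : 0 <= cf_fold s (0 : R) <= 1
  by apply: cf_fold_itv; rewrite // lexx ler01.
have /andP[f1 f1'] : 0 <= cf_fold s (1 : R) <= 1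
  by apply: cf_fold_itv; rewrite // lexx ler01.
rewrite -!/(cf_fold s _).
set x := cf_fold s 0 in f0 f0' *; set y := cf_fold s 1 in f1 f1' *.
(* Differencing the two inverses produces the sign absorbed by the extra -1. *)
have -> : (-1) ^+ (size s).+1 * ((c%:R + y)^-1 - (c%:R + x)^-1) =
  (-1) ^+ size s * (y - x) / ((c%:R + y) * (c%:R + x)) :> R.
  rewrite exprS; field.
  by apply/andP; split; apply: lt0r_neq0; lra.
by rewrite divr_ge0 ?IH// mulr_ge0; lra.
Qed.

Lemma uniform_prob01E (R : realType) (B : set R) : measurable B ->
  B `<=` `[0, 1] -> uniform_prob (@ltr01 R) B = lebesgue_measure B.
Proof.
move=> mB B01; rewrite /uniform_prob (eq_integral (cst 1%E)).
  by rewrite integral_cst// mul1e.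
move=> x; rewrite inE => /B01 /=; rewrite in_itv/= /uniform_pdf => ->.
by rewrite subr0 invr1.
Qed.

(** Adding any endpoints to an open interval leaves it convex. *)
Lemma measurable_sandwich_itv (R : realType) (a b : R) (B : set R) :
  `]a, b[ `<=` B -> B `<=` `[a, b] -> measurable B.
Proof.
move=> aB Bb; apply: is_interval_measurable => x y Bx By z /andP[xz zy].
have := Bb _ Bx; have := Bb _ By; rewrite /= !in_itv/= => /andP[_ yb] /andP[ax _].
move: xz; rewrite le_eqVlt => /predU1P[<-//|xz].
move: zy; rewrite le_eqVlt => /predU1P[->//|zy].
by apply: aB; rewrite /= in_itv/= (le_lt_trans ax) //= (lt_le_trans zy).
Qed.

Lemma lebesgue_measure_sandwich_itv (R : realType) (a b : R) (B : set R) :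
  a <= b -> `]a, b[ `<=` B -> B `<=` `[a, b] ->
  lebesgue_measure B = (b - a)%:E.
Proof.
move=> ab aB Bb; have mB := measurable_sandwich_itv aB Bb.
have itvE x y : lebesgue_measure [set` Interval (BSide x a) (BSide y b)] =
    (b - a)%:E.
  rewrite lebesgue_measure_itv/= lte_fin EFinB.
  by move: ab; rewrite le_eqVlt => /predU1P[->|->//]; rewrite ltxx subee.
apply/eqP; rewrite eq_le; apply/andP; split.
  by rewrite -(itvE true false); apply: le_measure; rewrite ?inE.
by rewrite -(itvE false true); apply: le_measure; rewrite ?inE.
Qed.

Lemma lebesgue_measure_cf_cylinder (R : realType) (s : seq nat) :
  all (ltn 0) s ->
  measurable (@cf_cylinder R s) /\
  lebesgue_measure (@cf_cylinder R s) =
    ((-1) ^+ size s * (cf_fold s 1 - cf_fold s 0))%:E.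
Proof.
move=> s0; have [sub sup] := @cf_cylinder_sandwich R s s0.
(* Only the parity of the length matters: it gives the order of x and y. *)
have := @cf_fold_sign R s s0; rewrite -signr_odd.
move: sub sup; set x := cf_fold s 0; set y := cf_fold s 1 => sub sup.
case: odd; rewrite /= ?expr1 ?expr0 ?mulN1r ?mul1r ?opprB subr_ge0 => xy.
  have aB : `]y, x[ `<=` @cf_cylinder R s.
    by move=> u /=; rewrite in_itv/= => ?; apply: sup; nra.
  have Bb : @cf_cylinder R s `<=` `[y, x].
    move=> u /sub hu; rewrite /= in_itv/=; apply/andP; split; nra.
  split; first exact: measurable_sandwich_itv aB Bb.
  exact: lebesgue_measure_sandwich_itv.
have aB : `]x, y[ `<=` @cf_cylinder R s.
  by move=> u /=; rewrite in_itv/= => ?; apply: sup; nra.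
have Bb : @cf_cylinder R s `<=` `[x, y].
  move=> u /sub hu; rewrite /= in_itv/=; apply/andP; split; nra.
split; first exact: measurable_sandwich_itv aB Bb.
exact: lebesgue_measure_sandwich_itv.
Qed.

Lemma cf_value_e_last (R : realType) (n : nat) (a : 'rV[nat]_n.+1) :
  cf_value R (a + e_last n.+1) =
    cf_fold [seq a ord0 i | i <- enum 'I_n.+1] 1.
Proof.
rewrite /cf_value /cf_fold enum_ordSr !map_rcons !foldr_rcons -!map_comp.
congr foldr; last first.
  by apply: eq_map => i /=; rewrite !mxE /= eqSS (ltn_eqF (ltn_ord i)) addr0.
by rewrite !mxE /= eqxx addr0 natrD.
Qed.

Lemma cf_coefs_cylinder (R : realType) (k : nat) (y : R) (a : 'rV[nat]_k) :
  cf_coefs k y = map_mx Posz a <->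
  cf_cylinder [seq a ord0 i | i <- enum 'I_k] (fracpart y).
Proof.
rewrite /cf_cylinder /= size_map size_enum_ord; split.
  move=> E; split=> [|i ik]; first exact: fracpart_itv.
  rewrite cf_coef_fracpart (nth_map (Ordinal ik)) ?size_enum_ord//.
  have /rowP/(_ (Ordinal ik)) := E; rewrite !mxE /= => ->.
  by congr (Posz (a _ _)); apply: val_inj; rewrite /= nth_enum_ord.
move=> [_ H]; apply/rowP => i; rewrite !mxE -cf_coef_fracpart H//.
by rewrite (nth_map i) ?size_enum_ord// nth_ord_enum.
Qed.

Theorem mainTheorem6 (R : realType) (d : measure_display)
    (T : measurableType d) (P : probability T R)
    (b : nat) (hb : (2 <= b)%N)
    (X : {RV P >-> R}) (hX : benford b X)
    (k : nat) (hk : (1 <= k)%N)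
    (a : 'rV[nat]_k) (ha : forall i : 'I_k, (1 <= a ord0 i)%N) :
  P [set t | cf_coefs k (logb b (X t)) = map_mx Posz a] =
    ((-1) ^+ k * (cf_value R (a + e_last k) - cf_value R a))%:E.
Proof.
case: k hk a ha => // n _ a ha; have [_ _ unif] := hX.
set s := [seq a ord0 i | i <- enum 'I_n.+1].
have s0 : all (ltn 0) s by apply/allP => _ /mapP[i _ ->]; exact: ha.
have [mB volB] := @lebesgue_measure_cf_cylinder R s s0.
have -> : [set t | cf_coefs n.+1 (logb b (X t)) = map_mx Posz a] =
    [set t | cf_cylinder s (fracpart (logb b (X t)))].
  by apply/seteqP; split=> t /cf_coefs_cylinder.
rewrite unif// uniform_prob01E//.
  by rewrite volB cf_value_e_last size_map size_enum_ord.
by move=> u [/andP[u0 u1] _]; rewrite /= in_itv/= u0 ltW.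
Qed.
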